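(* There exist a process template $P\in\mathcal{P}_u$ and parameterized topologies $\mathbf{G},\mathbf{H}$, which can be chosen to be computable sets of topologies, such that: (1) the parameterized model checking problem for $\mathbf{G}$, process $\{P\}$ and prenex indexed $\mathsf{LTL}\setminus\mathsf{X}$ specifications is undecidable; and (2) the parameterized model checking problem for $\mathbf{H}$, process $\{P\}$ and $2$-indexed $\mathsf{CTL}\setminus\mathsf{X}$ specifications is undecidable.
   Context: A process template $P\in\mathcal{P}_u$ is a finite LTS over atoms $\mathsf{AP}_{pr}$ with action labels $\Sigma_{int}\cup\{\mathsf{snd},\mathsf{rcv}\}$, states partitioned into nonempty token states $T$ and non-token states $N$, initial states $\{\iota_t,\iota_n\}$ ($\iota_t\in T,\iota_n\in N$), $\mathsf{snd}$-transitions $T\to N$, $\mathsf{rcv}$-transitions $N\to T$, internal transitions staying in $T$ or in $N$, every state having a successor, and every infinite action sequence in $(\Sigma_{int}^*\mathsf{snd}\Sigma_{int}^*\mathsf{rcv})^\omega\cup(\Sigma_{int}^*\mathsf{rcv}\Sigma_{int}^*\mathsf{snd})^\omega$. A topology is $G=(V,E,x)$, $V=[n]$, initial vertex $x$, irreflexive $E$; a parameterized topology is a countable set of topologies. The token-passing system $P^G$ has states $Q^V$, initial state with only $x$ holding the token ($x$ in $\iota_t$, others in $\iota_n$), labeling $p_i$ iff $p$ holds in the local state of $i$, internal transitions of single vertices and token-passing transitions along edges $(v,w)\in E$ (synchronous $\mathsf{snd}$ at $v$ and $\mathsf{rcv}$ at $w$). Prenex indexed $\mathsf{TL}$ formulas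 are $Q_1x_1\dots Q_kx_k.\varphi$ ($k\ge0$ arbitrary; $k$-indexed if exactly $k$ quantifiers) with index quantifiers $\forall/\exists$ over vertices (possibly restricted to named variables or to out-neighbours of a named vertex) and $\varphi\in\mathsf{TL}$ over atoms $p_{x_j}$; $P^G\models Q_1x_1\dots Q_kx_k.\varphi$ iff $Q_1g_1\in V_G\dots Q_kg_k\in V_G$: $P^G\models\varphi[p_{x_j}\mapsto p_{g_j}]$. $\mathsf{LTL}\setminus\mathsf{X}$, $\mathsf{CTL}\setminus\mathsf{X}$ denote those logics without the next-time operator. The PMCP for $\mathbf{G}$, process set $\mathcal{P}$ and formula class $\mathcal{F}$ is the problem: given $(\varphi,P)\in\mathcal{F}\times\mathcal{P}$, decide whether $P^G\models\varphi$ for all $G\in\mathbf{G}$. *)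

(* Defs.v *)
From mathcomp Require Import all_boot.
From Stdlib Require Cantor.
Set Implicit Arguments.
Unset Strict Implicit.
Unset Printing Implicit Defensive.

(* Kleene's partial recursive functions, in the presentation where every
   function is unary and several arguments are packed with Cantor's pairing. *)
Inductive recfun : Type :=
| RZero | RSucc | RFst | RSnd
| RPair of recfun & recfun
| RComp of recfun & recfun
| RPrim of recfun & recfun
| RMin of recfun.

Notation pack x y := (Cantor.to_nat (x, y)).

(* [reval f x y]: the partial function denoted by [f] is defined at [x] with
   value [y]. *)
Inductive reval : recfun -> nat -> nat -> Prop :=
| EZero x : reval RZero x 0
| ESucc x : reval RSucc x x.+1
| EFst x : reval RFst x (Cantor.of_nat x).1
| ESnd x : reval RSnd x (Cantor.of_nat x).2
| EPair f g x y z : reval f x y -> reval g x z -> reval (RPair f g) x (pack y z)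
| EComp f g x y z : reval g x y -> reval f y z -> reval (RComp f g) x z
| EPrim0 f g a y : reval f a y -> reval (RPrim f g) (pack a 0) y
| EPrimS f g a n y z :
    reval (RPrim f g) (pack a n) y -> reval g (pack a (pack n y)) z ->
    reval (RPrim f g) (pack a n.+1) z
| EMin f a n (h : nat -> nat) :
    reval f (pack a n) 0 ->
    (forall m, m < n -> reval f (pack a m) (h m).+1) ->
    reval (RMin f) a n.

(* The problem "given an instance [x] satisfying [D], decide whether [Y x]",
   where [code] presents instances as natural numbers. *)
Definition decidable_problem (I : Type) (code : I -> nat) (D Y : I -> Prop) :=
  exists f : recfun, forall x : I, D x ->
    (Y x /\ reval f (code x) 1) \/ (~ Y x /\ reval f (code x) 0).

Fixpoint seq_code (s : seq nat) : nat :=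
  if s is x :: s' then (pack x (seq_code s')).+1 else 0.

Record lts (AP : Type) := Lts {
  lts_state : Type;
  lts_action : Type;
  lts_init : lts_state -> Prop;
  lts_trans : lts_state -> lts_action -> lts_state -> Prop;
  lts_label : lts_state -> AP -> Prop
}.

Definition is_path (AP : Type) (M : lts AP) (pi : nat -> lts_state M) :=
  forall i, exists a, lts_trans (pi i) a (pi i.+1).

Inductive action (Sint : Type) := Internal of Sint | Snd | Rcv.
Arguments Snd {Sint}.
Arguments Rcv {Sint}.

(* The language of the words (Sint^* a Sint^* b). *)
Definition alternation (Sint : Type) (a b : action Sint)
    (w : seq (action Sint)) : Prop :=
  exists u v : seq Sint,
    w = map (@Internal Sint) u ++ a :: map (@Internal Sint) v ++ [:: b].

(* The infinite words that are concatenations of factors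
   w (f k), ..., w (f k.+1 - 1) from L. *)
Definition omega_power (A : Type) (L : seq A -> Prop) (w : nat -> A) : Prop :=
  exists f : nat -> nat, f 0 = 0 /\
    forall k, f k < f k.+1 /\ L (map w (index_iota (f k) (f k.+1))).

(* States are numbered and labels are finite lists, so that a template is a
   finite object that can be part of the input of a decision problem. *)
Record template (AP : countType) (Sint : finType) := Template {
  pt_size : nat;
  pt_token : {set 'I_pt_size};
  pt_init_t : 'I_pt_size;
  pt_init_n : 'I_pt_size;
  pt_trans : 'I_pt_size -> action Sint -> 'I_pt_size -> bool;
  pt_label : 'I_pt_size -> seq AP;
  pt_init_tP : pt_init_t \in pt_token;
  pt_init_nP : pt_init_n \notin pt_token;
  pt_transP : forall q a q', pt_trans q a q' ->
    match a with
    | Internal _ => (q \in pt_token) = (q' \in pt_token)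
    | Snd => (q \in pt_token) && (q' \notin pt_token)
    | Rcv => (q \notin pt_token) && (q' \in pt_token)
    end;
  pt_total : forall q, exists a q', pt_trans q a q';
  pt_alternate : forall (q : nat -> 'I_pt_size) (a : nat -> action Sint),
    (forall i, pt_trans (q i) (a i) (q i.+1)) ->
    omega_power (alternation Snd Rcv) a \/ omega_power (alternation Rcv Snd) a
}.

Definition template_code (AP : countType) (Sint : finType)
    (P : template AP Sint) : nat :=
  let states := enum 'I_(pt_size P) in
  let actions := [:: Snd; Rcv] ++ map (@Internal Sint) (enum Sint) in
  seq_code
    [:: pt_size P; nat_of_ord (pt_init_t P); nat_of_ord (pt_init_n P);
        seq_code [seq nat_of_bool (q \in pt_token P) | q <- states];
        seq_code [seq seq_code [seq seq_code
                    [seq nat_of_bool (pt_trans q a q') | q' <- states]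
                  | a <- actions] | q <- states];
        seq_code [seq seq_code [seq pickle p | p <- pt_label q]
                 | q <- states]].

Record topology := Topology {
  top_size : nat;
  top_init : 'I_top_size;
  top_edge : rel 'I_top_size;
  top_irrefl : irreflexive top_edge
}.

Definition topology_code (G : topology) : nat :=
  let V := enum 'I_(top_size G) in
  seq_code
    [:: top_size G; nat_of_ord (top_init G);
        seq_code [seq seq_code [seq nat_of_bool (top_edge v w) | w <- V]
                 | v <- V]].

(* Every set of (finite) topologies on initial segments of nat is countable. *)
Definition ptopology := topology -> Prop.

Definition computable_ptopology (G : ptopology) : Prop :=
  decidable_problem topology_code (fun _ => True) G.

Section System.
Variables (AP : countType) (Sint : finType).
Variables (P : template AP Sint) (G : topology).

Let V := 'I_(top_size G).
Definition sys_state := {ffun V -> 'I_(pt_size P)}.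

(* [None] is the label of the token-passing transitions. *)
Definition sys_trans (s : sys_state) (l : option Sint) (s' : sys_state) : Prop :=
  match l with
  | Some a => exists v : V,
      pt_trans (s v) (Internal a) (s' v) /\ (forall u, u != v -> s' u = s u)
  | None => exists v w : V,
      [/\ top_edge v w, pt_trans (s v) Snd (s' v), pt_trans (s w) Rcv (s' w)
        & forall u, u != v -> u != w -> s' u = s u]
  end.

Definition token_system : lts (AP * V) := {|
  lts_state := sys_state;
  lts_action := option Sint;
  lts_init := fun s =>
    s = [ffun v => if v == top_init G then pt_init_t P else pt_init_n P];
  lts_trans := sys_trans;
  lts_label := fun s pv => pv.1 \in pt_label (s pv.2)
|}.
End System.

Definition until (A B : nat -> Prop) : Prop :=
  exists i, B i /\ forall j, j < i -> A j.

(* A logic [TL], with formulas over an arbitrary type of atoms. *)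
Record logic := Logic {
  formula : Type -> Type;
  fmap : forall A B : Type, (A -> B) -> formula A -> formula B;
  atoms : forall A : Type, formula A -> seq A;
  fcode : forall A : Type, (A -> nat) -> formula A -> nat;
  sat : forall (A : Type) (M : lts A), formula A -> Prop
}.

Inductive ltlx (A : Type) : Type :=
| LTrue
| LAtom of A
| LNot of ltlx A
| LAnd of ltlx A & ltlx A
| LUntil of ltlx A & ltlx A.

Fixpoint ltlx_map (A B : Type) (h : A -> B) (f : ltlx A) : ltlx B :=
  match f with
  | LTrue => LTrue B
  | LAtom a => LAtom (h a)
  | LNot f => LNot (ltlx_map h f)
  | LAnd f g => LAnd (ltlx_map h f) (ltlx_map h g)
  | LUntil f g => LUntil (ltlx_map h f) (ltlx_map h g)
  end.

Fixpoint ltlx_atoms (A : Type) (f : ltlx A) : seq A :=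
  match f with
  | LTrue => [::]
  | LAtom a => [:: a]
  | LNot f => ltlx_atoms f
  | LAnd f g | LUntil f g => ltlx_atoms f ++ ltlx_atoms g
  end.

Fixpoint ltlx_code (A : Type) (c : A -> nat) (f : ltlx A) : nat :=
  match f with
  | LTrue => pack 0 0
  | LAtom a => pack 1 (c a)
  | LNot f => pack 2 (ltlx_code c f)
  | LAnd f g => pack 3 (pack (ltlx_code c f) (ltlx_code c g))
  | LUntil f g => pack 4 (pack (ltlx_code c f) (ltlx_code c g))
  end.

Fixpoint ltlx_holds (A : Type) (M : lts A) (f : ltlx A)
    (pi : nat -> lts_state M) : Prop :=
  match f with
  | LTrue => True
  | LAtom a => lts_label (pi 0) a
  | LNot f => ~ ltlx_holds f pi
  | LAnd f g => ltlx_holds f pi /\ ltlx_holds g pi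
  | LUntil f g => until (fun i => ltlx_holds f (fun n => pi (i + n)))
                        (fun i => ltlx_holds g (fun n => pi (i + n)))
  end.

Definition ltlx_sat (A : Type) (M : lts A) (f : ltlx A) : Prop :=
  forall pi : nat -> lts_state M,
    lts_init (pi 0) -> is_path pi -> ltlx_holds f pi.

Definition LTLX : logic := Logic ltlx_map ltlx_atoms ltlx_code ltlx_sat.

(* The remaining operators are definable, e.g. EG f = ~ A(true U ~ f). *)
Inductive ctlx (A : Type) : Type :=
| CTrue
| CAtom of A
| CNot of ctlx A
| CAnd of ctlx A & ctlx A
| CEUntil of ctlx A & ctlx A
| CAUntil of ctlx A & ctlx A.

Fixpoint ctlx_map (A B : Type) (h : A -> B) (f : ctlx A) : ctlx B :=
  match f with
  | CTrue => CTrue B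
  | CAtom a => CAtom (h a)
  | CNot f => CNot (ctlx_map h f)
  | CAnd f g => CAnd (ctlx_map h f) (ctlx_map h g)
  | CEUntil f g => CEUntil (ctlx_map h f) (ctlx_map h g)
  | CAUntil f g => CAUntil (ctlx_map h f) (ctlx_map h g)
  end.

Fixpoint ctlx_atoms (A : Type) (f : ctlx A) : seq A :=
  match f with
  | CTrue => [::]
  | CAtom a => [:: a]
  | CNot f => ctlx_atoms f
  | CAnd f g | CEUntil f g | CAUntil f g => ctlx_atoms f ++ ctlx_atoms g
  end.

Fixpoint ctlx_code (A : Type) (c : A -> nat) (f : ctlx A) : nat :=
  match f with
  | CTrue => pack 0 0
  | CAtom a => pack 1 (c a)
  | CNot f => pack 2 (ctlx_code c f)
  | CAnd f g => pack 3 (pack (ctlx_code c f) (ctlx_code c g))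
  | CEUntil f g => pack 4 (pack (ctlx_code c f) (ctlx_code c g))
  | CAUntil f g => pack 5 (pack (ctlx_code c f) (ctlx_code c g))
  end.

Fixpoint ctlx_holds (A : Type) (M : lts A) (f : ctlx A)
    (s : lts_state M) : Prop :=
  match f with
  | CTrue => True
  | CAtom a => lts_label s a
  | CNot f => ~ ctlx_holds f s
  | CAnd f g => ctlx_holds f s /\ ctlx_holds g s
  | CEUntil f g => exists pi : nat -> lts_state M,
      [/\ pi 0 = s, is_path pi &
          until (fun i => ctlx_holds f (pi i)) (fun i => ctlx_holds g (pi i))]
  | CAUntil f g => forall pi : nat -> lts_state M,
      pi 0 = s -> is_path pi ->
      until (fun i => ctlx_holds f (pi i)) (fun i => ctlx_holds g (pi i))
  end.

Definition ctlx_sat (A : Type) (M : lts A) (f : ctlx A) : Prop :=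
  forall s : lts_state M, lts_init s -> ctlx_holds f s.

Definition CTLX : logic := Logic ctlx_map ctlx_atoms ctlx_code ctlx_sat.

(* Index variables are named by the position of their quantifier in the
   prefix, counted from 0. A quantifier ranges over all vertices, over the
   values of a list of earlier variables, or over the out-neighbours of the
   value of an earlier variable. *)
Inductive range := RAll | RVars of seq nat | RNbrs of nat.
Inductive quantifier := QForall of range | QExists of range.

Definition range_of (Q : quantifier) : range :=
  match Q with QForall r | QExists r => r end.

Record prenex (L : logic) (AP : countType) := Prenex {
  px_prefix : seq quantifier;
  px_matrix : formula L (AP * nat)
}.

Definition range_closed (i : nat) (r : range) : bool :=
  match r with
  | RAll => true
  | RVars js => all (fun j => j < i) js
  | RNbrs j => j < i
  end.

Fixpoint prefix_closed (i : nat) (Qs : seq quantifier) : bool :=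
  if Qs is Q :: Qs' then range_closed i (range_of Q) && prefix_closed i.+1 Qs'
  else true.

Definition prenex_closed (L : logic) (AP : countType) (f : prenex L AP) : Prop :=
  prefix_closed 0 (px_prefix f) /\
  all (fun pj => pj.2 < size (px_prefix f)) (atoms (px_matrix f)).

Definition range_code (r : range) : nat :=
  match r with
  | RAll => pack 0 0
  | RVars js => pack 1 (seq_code js)
  | RNbrs j => pack 2 j
  end.

Definition quantifier_code (Q : quantifier) : nat :=
  match Q with
  | QForall r => pack 0 (range_code r)
  | QExists r => pack 1 (range_code r)
  end.

Definition prenex_code (L : logic) (AP : countType) (f : prenex L AP) : nat :=
  pack (seq_code (map quantifier_code (px_prefix f)))
       (fcode (fun pj : AP * nat => pack (pickle pj.1) pj.2) (px_matrix f)).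

Section Models.
Variables (L : logic) (AP : countType) (Sint : finType).
Variables (P : template AP Sint) (G : topology).

Let V := 'I_(top_size G).

(* An environment lists the vertices chosen so far; the default value is
   irrelevant for closed formulas. *)
Definition value (env : seq V) (j : nat) : V := nth (top_init G) env j.

Definition in_range (env : seq V) (r : range) (g : V) : bool :=
  match r with
  | RAll => true
  | RVars js => g \in map (value env) js
  | RNbrs j => top_edge (value env j) g
  end.

Fixpoint models_under (Qs : seq quantifier) (f : formula L (AP * nat))
    (env : seq V) : Prop :=
  match Qs with
  | [::] => sat (token_system P G) (fmap (fun pj => (pj.1, value env pj.2)) f)
  | QForall r :: Qs' =>
      forall g : V, in_range env r g -> models_under Qs' f (rcons env g)
  | QExists r :: Qs' =>
      exists2 g : V, in_range env r g & models_under Qs' f (rcons env g)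
  end.

Definition models (f : prenex L AP) : Prop :=
  models_under (px_prefix f) (px_matrix f) [::].
End Models.

Definition k_indexed (k : nat) (L : logic) (AP : countType) (f : prenex L AP) : Prop :=
  prenex_closed f /\ size (px_prefix f) = k.

Definition pmcp_decidable (L : logic) (AP : countType) (Sint : finType)
    (G : ptopology) (Ps : template AP Sint -> Prop) (F : prenex L AP -> Prop) :=
  decidable_problem
    (fun i : prenex L AP * template AP Sint =>
       pack (prenex_code i.1) (template_code i.2))
    (fun i => F i.1 /\ Ps i.2)
    (fun i => forall T : topology, G T -> models i.2 T i.1).

(* Main.v *)
Require Import Defs.
From mathcomp Require Import all_boot.
From mathcomp Require Import zify.
From Stdlib Require Cantor.

Set Implicit Arguments.
Unset Strict Implicit.
Unset Printing Implicit Defensive.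

(* The halting predicate "the recursive function coded by e maps e to 1" is the
   projection of a decidable relation "s certifies e", and it is not decidable.
   For each pair (e, s) in this relation, take a topology whose reachable part
   has a shape determined by e and whose number of vertices also determines s:
   this is a decidable set of topologies. If a formula phi_e, computable from e,
   fails exactly on the shape of parameter e, then phi_e holds on the whole set
   if and only if no s certifies e, so that the model checking problem is
   undecidable. The template only passes the token, hence the runs of the system
   are the walks in the topology.

   For LTL the shape is a lasso (a path that ends in a 2-cycle): binding the
   variables to the successive vertices of a walk by quantifiers over
   out-neighbours, the entry point of the 2-cycle is read off from the first
   coincidence of the i-th and the (i+2)-nd vertex. For CTL the shape is a
   descending ladder, whose rungs are counted by nested until operators that only
   refer to the initial vertex; the second index variable is a dummy. *)

Local Arguments Cantor.to_nat : simpl never.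
Local Arguments Cantor.of_nat : simpl never.

(** * Total recursive functions *)

Notation p1 z := (Cantor.of_nat z).1.
Notation p2 z := (Cantor.of_nat z).2.

Lemma pack_p1 x y : p1 (pack x y) = x.
Proof. by rewrite Cantor.cancel_of_to. Qed.

Lemma pack_p2 x y : p2 (pack x y) = y.
Proof. by rewrite Cantor.cancel_of_to. Qed.

Definition packE := (pack_p1, pack_p2).

Lemma pack_surj z : pack (p1 z) (p2 z) = z.
Proof. by rewrite -surjective_pairing Cantor.cancel_to_of. Qed.

Lemma leq_pack x y : x + y <= pack x y.
Proof. have := Cantor.to_nat_non_decreasing x y; lia. Qed.

Lemma leq_p1 z : p1 z <= z.
Proof. by rewrite -{2}(pack_surj z); apply: leq_trans (leq_pack _ _); apply: leq_addr. Qed.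

Lemma leq_p2 z : p2 z <= z.
Proof. by rewrite -{2}(pack_surj z); apply: leq_trans (leq_pack _ _); apply: leq_addl. Qed.

Definition total_recursive (F : nat -> nat) : Prop :=
  exists f, forall x, reval f x (F x).

Notation recursive_pred P := (total_recursive (fun x => nat_of_bool (P x))).

Lemma rec_ext F G : F =1 G -> total_recursive F -> total_recursive G.
Proof. by move=> FG [f Hf]; exists f => x; rewrite -FG. Qed.

Lemma rec_comp F G :
  total_recursive F -> total_recursive G -> total_recursive (fun x => F (G x)).
Proof. by move=> [f Hf] [g Hg]; exists (RComp f g) => x; apply: EComp. Qed.

Lemma rec_pack F G :
  total_recursive F -> total_recursive G ->
  total_recursive (fun x => pack (F x) (G x)).
Proof. by move=> [f Hf] [g Hg]; exists (RPair f g) => x; apply: EPair. Qed.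

Lemma rec_p1 F : total_recursive F -> total_recursive (fun x => p1 (F x)).
Proof. exact: (@rec_comp (fun z => p1 z) _ (ex_intro _ RFst EFst)). Qed.

Lemma rec_p2 F : total_recursive F -> total_recursive (fun x => p2 (F x)).
Proof. exact: (@rec_comp (fun z => p2 z) _ (ex_intro _ RSnd ESnd)). Qed.

Lemma rec_succ F : total_recursive F -> total_recursive (fun x => (F x).+1).
Proof. exact: (@rec_comp succn _ (ex_intro _ RSucc ESucc)). Qed.

Lemma rec_id : total_recursive (fun x => x).
Proof.
exists (RPair RFst RSnd) => x; rewrite -{2}(pack_surj x).
by apply: EPair; [apply: EFst|apply: ESnd].
Qed.

Lemma rec_const c : total_recursive (fun=> c).
Proof. by elim: c => [|c IH]; [exists RZero; apply: EZero | apply: rec_succ]. Qed.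

(** The parameter [x] stays in the first component of the packed argument of [RPrim], and
    composition with [pack x (N x)] sets the number of rounds. Arithmetic and bounded quantifiers
    reduce to this. *)
Lemma rec_nat_rect (B : nat -> nat -> nat -> nat) A N :
  total_recursive A ->
  total_recursive (fun z => B (p1 z) (p1 (p2 z)) (p2 (p2 z))) ->
  total_recursive N ->
  total_recursive (fun x => nat_rect (fun=> nat) (A x) (B x) (N x)).
Proof.
move=> [a Ha] [b Hb] HN.
have [f Hf] : total_recursive
    (fun z => nat_rect (fun=> nat) (A (p1 z)) (B (p1 z)) (p2 z)).
  exists (RPrim a b) => z; rewrite -{1}(pack_surj z).
  elim: (p2 z) => [|n IH] /=; first exact: EPrim0.
  apply: (EPrimS IH).
  by have := Hb (pack (p1 z) (pack n (nat_rect (fun=> nat) (A (p1 z)) (B (p1 z)) n)));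
    rewrite !packE.
apply: rec_ext (rec_comp (ex_intro _ f Hf) (rec_pack rec_id HN)) => x.
by rewrite !packE.
Qed.

Lemma rec_pred F : total_recursive F -> total_recursive (fun x => (F x).-1).
Proof.
move=> HF; apply: (@rec_ext (fun x => nat_rect (fun=> nat) 0 (fun n _ => n) (F x))).
  by move=> x; case: (F x).
by apply: (@rec_nat_rect (fun _ n _ => n)) => //;
  [apply: rec_const | apply/rec_p1/rec_p2/rec_id].
Qed.

Lemma rec_iter (h : nat -> nat) A N :
  (forall F, total_recursive F -> total_recursive (fun x => h (F x))) ->
  total_recursive A -> total_recursive N ->
  total_recursive (fun x => iter (N x) h (A x)).
Proof.
move=> Hh HA HN.
apply: (@rec_ext (fun x => nat_rect (fun=> nat) (A x) (fun _ r => h r) (N x))).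
  by move=> x; elim: (N x) => //= n ->.
by apply: (@rec_nat_rect (fun _ _ r => h r)) => //; apply/Hh/rec_p2/rec_p2/rec_id.
Qed.

Lemma rec_add F G : total_recursive F -> total_recursive G ->
  total_recursive (fun x => F x + G x).
Proof.
move=> HF HG; apply: (@rec_ext (fun x => iter (F x) succn (G x))).
  by move=> x; rewrite iter_succn addnC.
by apply: rec_iter HG HF; apply: rec_succ.
Qed.

Lemma rec_sub F G : total_recursive F -> total_recursive G ->
  total_recursive (fun x => F x - G x).
Proof.
move=> HF HG; apply: (@rec_ext (fun x => iter (G x) predn (F x))).
  by move=> x; rewrite iter_predn.
by apply: rec_iter HF HG; apply: rec_pred.
Qed.

Lemma rec_if (c : nat -> bool) F G :
  recursive_pred c -> total_recursive F -> total_recursive G ->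
  total_recursive (fun x => if c x then F x else G x).
Proof.
move=> Hc HF HG.
apply: (@rec_ext (fun x => nat_rect (fun=> nat) (G x) (fun _ _ => F x) (c x))).
  by move=> x; case: (c x).
by apply: (@rec_nat_rect (fun x _ _ => F x)) => //; apply: rec_comp HF (rec_p1 rec_id).
Qed.

Lemma rec_if_pred (c P Q : nat -> bool) :
  recursive_pred c -> recursive_pred P -> recursive_pred Q ->
  recursive_pred (fun x => if c x then P x else Q x).
Proof.
move=> Hc HP HQ; apply: rec_ext (rec_if Hc HP HQ) => x.
by case: (c x).
Qed.

Lemma rec_true : recursive_pred (fun=> true).
Proof. exact: rec_const 1. Qed.

Lemma rec_false : recursive_pred (fun=> false).
Proof. exact: rec_const 0. Qed.

Lemma rec_neg (P : nat -> bool) : recursive_pred P -> recursive_pred (fun x => ~~ P x).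
Proof. by move=> HP; apply: rec_if_pred HP rec_false rec_true. Qed.

Lemma rec_and (P Q : nat -> bool) : recursive_pred P -> recursive_pred Q ->
  recursive_pred (fun x => P x && Q x).
Proof. by move=> HP HQ; apply: rec_if_pred HP HQ rec_false. Qed.

Lemma rec_or (P Q : nat -> bool) : recursive_pred P -> recursive_pred Q ->
  recursive_pred (fun x => P x || Q x).
Proof. by move=> HP HQ; apply: rec_if_pred HP rec_true HQ. Qed.

Lemma rec_leq F G : total_recursive F -> total_recursive G ->
  recursive_pred (fun x => F x <= G x).
Proof.
move=> HF HG.
apply: (@rec_ext (fun x => nat_rect (fun=> nat) 1 (fun _ _ => 0) (F x - G x))).
  by move=> x; rewrite /leq; case: (F x - G x).
by apply: (@rec_nat_rect (fun _ _ _ => 0)) (rec_sub HF HG); apply: rec_const.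
Qed.

Lemma rec_eq F G : total_recursive F -> total_recursive G ->
  recursive_pred (fun x => F x == G x).
Proof.
move=> HF HG; apply: (@rec_ext (fun x => nat_of_bool ((F x <= G x) && (G x <= F x)))).
  by move=> x; rewrite eqn_leq.
by apply: rec_and; apply: rec_leq.
Qed.

Lemma rec_odd F : total_recursive F -> recursive_pred (fun x => odd (F x)).
Proof.
move=> HF; apply: (@rec_ext (fun x => iter (F x) (fun b => 1 - b) 0)).
  by move=> x; elim: (F x) => //= n ->; case: odd.
by apply: rec_iter (rec_const 0) HF => F' HF'; apply: rec_sub (rec_const 1) HF'.
Qed.

Lemma rec_has (P : nat -> nat -> bool) N :
  recursive_pred (fun z => P (p1 z) (p2 z)) -> total_recursive N ->
  recursive_pred (fun x => has (P x) (iota 0 (N x))).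
Proof.
move=> HP HN.
apply: (@rec_ext (fun x => nat_rect (fun=> nat) 0
          (fun n r => if P x n then 1 else r) (N x))).
  move=> x; elim: (N x) => // n; rewrite -(addn1 n) iotaD has_cat addn1 /= => ->.
  by rewrite orbF orbC; case: (P x n).
apply: (@rec_nat_rect (fun x n r => if P x n then 1 else r)) => //.
  exact: rec_const.
apply: rec_if; [|exact: rec_const|exact/rec_p2/rec_p2/rec_id].
apply: rec_ext (rec_comp HP
  (rec_pack (rec_p1 rec_id) (rec_p1 (rec_p2 rec_id)))) => z.
by rewrite !packE.
Qed.

Lemma rec_all (P : nat -> nat -> bool) N :
  recursive_pred (fun z => P (p1 z) (p2 z)) -> total_recursive N ->
  recursive_pred (fun x => all (P x) (iota 0 (N x))).
Proof.
move=> HP HN.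
apply: (@rec_ext (fun x => nat_of_bool (~~ has (fun n => ~~ P x n) (iota 0 (N x))))).
  by move=> x; rewrite -all_predC; congr nat_of_bool; apply: eq_all => n /=; rewrite negbK.
by apply/rec_neg/(@rec_has (fun x n => ~~ P x n))=> //; apply: rec_neg.
Qed.

(** A nonempty list is coded by the successor of a pair, so a predecessor exposes head and tail. The
    code 0 of the empty list is its own tail and has head 0, so reading past the end gives 0. *)
Definition code_behead (s : nat) := p2 s.-1.
Definition code_nth (s i : nat) := p1 (iter i code_behead s).-1.

Lemma code_nthE l i : code_nth (seq_code l) i = nth 0 l i.
Proof.
rewrite /code_nth; elim: i l => [|i IH] [|x l]; rewrite ?iterSr /= ?packE //.
- have -> : code_behead 0 = seq_code [::] by [].
  by rewrite IH nth_nil.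
- by rewrite /code_behead /= packE.
Qed.

Lemma code_nth_le s i : code_nth s i <= s.-1.
Proof.
apply: leq_trans (leq_p1 _) _; rewrite -!subn1 leq_sub2r //.
elim: i => //= i; apply: leq_trans; rewrite /code_behead.
exact: leq_trans (leq_p2 _) (leq_pred _).
Qed.

Lemma rec_code_nth F G : total_recursive F -> total_recursive G ->
  total_recursive (fun x => code_nth (F x) (G x)).
Proof.
move=> HF HG; apply/rec_p1/rec_pred/rec_iter => //.
by move=> F' HF'; apply/rec_p2/rec_pred.
Qed.

Lemma seq_code_size l : size l <= seq_code l.
Proof.
elim: l => //= x l IH; rewrite ltnS; apply: leq_trans IH _.
exact: leq_trans (leq_addl _ _) (leq_pack x _).
Qed.

Lemma rec_seq_code_iota (B : nat -> nat -> nat) N :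
  total_recursive (fun z => B (p1 z) (p2 z)) -> total_recursive N ->
  total_recursive (fun x => seq_code [seq B x i | i <- iota 0 (N x)]).
Proof.
move=> HB HN.
apply: (@rec_ext (fun x => nat_rect (fun=> nat) 0
          (fun n r => (pack (B x (N x - n.+1)) r).+1) (N x))).
  move=> x.
  (* Lists are coded from the tail: after [n] rounds the accumulator codes the last [n] entries. *)
  suff tails n : n <= N x -> nat_rect (fun=> nat) 0
      (fun n r => (pack (B x (N x - n.+1)) r).+1) n =
      seq_code [seq B x i | i <- iota (N x - n) n] by rewrite tails // subnn.
  by elim: n => //= n IH lt_n; rewrite IH ?(ltnW lt_n) // subnSK.
apply: (@rec_nat_rect (fun x n r => (pack (B x (N x - n.+1)) r).+1)) => //.
  exact: rec_const.
apply/rec_succ/rec_pack; last exact/rec_p2/rec_p2/rec_id.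
have H : total_recursive (fun z => pack (p1 z) (N (p1 z) - (p1 (p2 z)).+1)).
  apply/rec_pack/rec_sub; [exact/rec_p1/rec_id| |exact/rec_succ/rec_p1/rec_p2/rec_id].
  exact: rec_comp HN (rec_p1 rec_id).
by apply: rec_ext (rec_comp HB H) => z; rewrite !packE.
Qed.

(** A hook for the tactic [rec], redefined later as further operations are shown to be recursive. *)
Ltac rec_code := apply: rec_code_nth.
Ltac rec_step := first
  [ assumption | rec_code | exact: rec_id | exact: rec_const | exact: rec_true | exact: rec_false
  | apply: rec_and | apply: rec_or | apply: rec_neg | apply: rec_eq | apply: rec_leq
  | apply: rec_odd | apply: rec_has | apply: rec_all | apply: rec_if_pred
  | apply: rec_if | apply: rec_p1 | apply: rec_p2 | apply: rec_pack
  | apply: rec_sub | apply: rec_add | apply: rec_succ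
  | apply: rec_pred
  | match goal with H : total_recursive ?F |- total_recursive (fun z => ?F (@?G z)) =>
      refine (@rec_comp F G H _) end ].
Ltac rec := repeat rec_step.

(** * Halting certificates *)

(** [EMin] asks for the values below the minimum as one function; finitely many witnesses can be
    collected by induction, without a choice axiom. *)
Lemma finite_choice (R : nat -> nat -> Prop) n :
  (forall m, m < n -> exists k, R m k) ->
  exists h, forall m, m < n -> R m (h m).
Proof.
elim: n => [|n IH] Rn; first by exists id.
have [|h Hh] := IH; first by move=> m lt_mn; apply: Rn; apply: ltnW.
have [k Hk] := Rn n (ltnSn n).
exists (fun m => if m == n then k else h m) => m; rewrite ltnS leq_eqVlt.
by have [-> //|_ /= lt_mn] := eqVneq m n; apply: Hh.
Qed.

(** Inversion phrased with projections: [pack] is not a constructor, so plain inversion would leave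
    equations between pairings. *)
Lemma reval_inv f x y : reval f x y ->
  match f with
  | RZero => y = 0
  | RSucc => y = x.+1
  | RFst => y = p1 x
  | RSnd => y = p2 x
  | RPair f g => reval f x (p1 y) /\ reval g x (p2 y)
  | RComp f g => exists2 z, reval g x z & reval f z y
  | RPrim f g =>
    if p2 x is n.+1 then
      exists2 z, reval (RPrim f g) (pack (p1 x) n) z &
                 reval g (pack (p1 x) (pack n z)) y
    else reval f (p1 x) y
  | RMin f => reval f (pack x y) 0 /\
              forall m, m < y -> exists k, reval f (pack x m) k.+1
  end.
Proof.
case=> //=.
- by move=> {}f g {}x {}y z fy gz; rewrite !packE.
- by move=> {}f g {}x {}y z; exists y.
- by move=> {}f g a {}y; rewrite !packE.
- by move=> {}f g a n {}y z; rewrite !packE; exists y.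
- by move=> {}f a n h f0 fh; split=> // m lt_mn; exists (h m); apply: fh.
Qed.

Lemma reval_functional f x y z : reval f x y -> reval f x z -> y = z.
Proof.
move=> fxy; elim: fxy z => {f x y}
  [x|x|x|x|f g x y z _ IHf _ IHg|f g x y z _ IHg _ IHf|f g a y _ IH
  |f g a n y z _ IHy _ IHz|f a n h _ IH0 _ IHh] t /reval_inv //.
- by move=> [/IHf -> /IHg ->]; rewrite pack_surj.
- by move=> [u /IHg <- /IHf].
- by rewrite !packE => /IH.
- by rewrite !packE => -[u /IHy <- /IHz].
(* At the smaller of two distinct minima, [f] would have both the value 0 and a positive value. *)
- move=> [ft0 ft]; case: (ltngtP n t) => // [lt_nt|lt_tn].
    by have [k /IH0] := ft n lt_nt.
  by have := IHh t lt_tn _ ft0.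
Qed.

(** * Codes of recursive functions, and finite lists of judgments as certificates *)

Fixpoint recfun_code (f : recfun) : nat :=
  match f with
  | RZero => pack 0 0
  | RSucc => pack 1 0
  | RFst => pack 2 0
  | RSnd => pack 3 0
  | RPair f g => pack 4 (pack (recfun_code f) (recfun_code g))
  | RComp f g => pack 5 (pack (recfun_code f) (recfun_code g))
  | RPrim f g => pack 6 (pack (recfun_code f) (recfun_code g))
  | RMin f => pack 7 (recfun_code f)
  end.

(* One backward step of the evaluation rules of [reval], on codes: the judgment
   "[f] maps [x] to [y]" has its premises in [M]. *)
Definition justified (M : nat -> nat -> nat -> Prop) (f x y : nat) : Prop :=
  let a := p2 f in
  match p1 f with
  | 0 => y = 0
  | 1 => y = x.+1
  | 2 => y = p1 x
  | 3 => y = p2 x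
  | 4 => M (p1 a) x (p1 y) /\ M (p2 a) x (p2 y)
  | 5 => exists2 z, M (p2 a) x z & M (p1 a) z y
  | 6 =>
    if p2 x is n.+1 then
      exists2 z, M f (pack (p1 x) n) z & M (p2 a) (pack (p1 x) (pack n z)) y
    else M (p1 a) (p1 x) y
  | _ => M a (pack x y) 0 /\ forall m, m < y -> exists k, M a (pack x m) k.+1
  end.

Lemma justified_sub (M M' : nat -> nat -> nat -> Prop) f x y :
  (forall f x y, M f x y -> M' f x y) -> justified M f x y -> justified M' f x y.
Proof.
move=> MM'; rewrite /justified.
case: (p1 f) => [|[|[|[|[|[|[|_]]]]]]] //.
- by case=> /MM' ? /MM'.
- by case=> z /MM' ? /MM'; exists z.
- by case: (p2 x) => [/MM' //|n [z /MM' ? /MM']]; exists z.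
- by case=> /MM' ? H; split=> // m /H [k /MM']; exists k.
Qed.

(* No well-foundedness of the justification is required: along the rules, the
   function gets smaller, or stays the same with a smaller recursion argument. *)
Lemma justified_sound (M : nat -> nat -> nat -> Prop) :
  (forall f x y, M f x y -> justified M f x y) ->
  forall f x y, M (recfun_code f) x y -> reval f x y.
Proof.
move=> just; elim=> [|||| f IHf g IHg | f IHf g IHg | f IHf g IHg | f IHf] x y
  /just; rewrite /justified /= ?packE.
- by move=> ->; apply: EZero.
- by move=> ->; apply: ESucc.
- by move=> ->; apply: EFst.
- by move=> ->; apply: ESnd.
- by move=> [/IHf fy /IHg gy]; rewrite -(pack_surj y); apply: EPair.
- by move=> [z /IHg gz /IHf]; apply: EComp.
- rewrite -[X in _ -> reval _ X _](pack_surj x); elim: (p2 x) y => [|n IH] y.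
    by move=> /IHf; apply: EPrim0.
  move=> [z /just]; rewrite /justified !packE => /IH Hz /IHg.
  exact: EPrimS.
- move=> [/IHf f0 Hf].
  have [h Hh] := finite_choice Hf.
  by apply: (EMin (h := h)) => // m /Hh /IHf.
Qed.

Definition in_list (l : seq nat) (f x y : nat) : Prop := pack f (pack x y) \in l.

Definition closed_list (l : seq nat) :=
  forall f x y, in_list l f x y -> justified (in_list l) f x y.

Lemma closed_cat l1 l2 : closed_list l1 -> closed_list l2 -> closed_list (l1 ++ l2).
Proof.
move=> c1 c2 f x y; rewrite /in_list mem_cat => /orP[/c1|/c2];
by apply: justified_sub => f' x' y'; rewrite /in_list mem_cat => ->; rewrite ?orbT.
Qed.

Lemma closed_cons l f x y :
  closed_list l -> justified (in_list l) f x y ->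
  closed_list (pack f (pack x y) :: l).
Proof.
have sub f' x' y' : in_list l f' x' y' -> in_list (pack f (pack x y) :: l) f' x' y'.
  by rewrite /in_list inE => ->; rewrite orbT.
move=> cl jl f' x' y'; rewrite {1}/in_list inE => /orP[/eqP e|/cl]; last first.
  exact: justified_sub.
have -> : f' = f by have := congr1 (fun z => p1 z) e; rewrite !packE.
have -> : x' = x by have := congr1 (fun z => p1 (p2 z)) e; rewrite !packE.
have -> : y' = y by have := congr1 (fun z => p2 (p2 z)) e; rewrite !packE.
exact: justified_sub jl.
Qed.

(** The list gathers the judgments of the derivation tree: the lists of the premises, finite in
    number, are concatenated and the conclusion is added in front. *)
Lemma justified_complete f x y : reval f x y ->
  exists2 l, closed_list l & in_list l (recfun_code f) x y.
Proof.
have add l g u v : closed_list l -> justified (in_list l) (recfun_code g) u v ->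
    exists2 l, closed_list l & in_list l (recfun_code g) u v.
  move=> cl jl; exists (pack (recfun_code g) (pack u v) :: l).
    exact: closed_cons.
  by rewrite /in_list mem_head.
have nil_closed : closed_list [::] by [].
elim=> {f x y}
  [x|x|x|x|f g x y z _ [l1 c1 i1] _ [l2 c2 i2]|f g x y z _ [l1 c1 i1] _ [l2 c2 i2]
  |f g a y _ [l1 c1 i1]|f g a n y z _ [l1 c1 i1] _ [l2 c2 i2]
  |f a n h _ [l1 c1 i1] _ IHh].
- by apply: (add [::]) => //; rewrite /justified /= ?packE.
- by apply: (add [::]) => //; rewrite /justified /= ?packE.
- by apply: (add [::]) => //; rewrite /justified /= ?packE.
- by apply: (add [::]) => //; rewrite /justified /= ?packE.
- apply: (add (l1 ++ l2)); first exact: closed_cat.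
  by rewrite /justified /= ?packE /in_list !mem_cat i1 i2 orbT.
- apply: (add (l1 ++ l2)); first exact: closed_cat.
  by rewrite /justified /= ?packE; exists y; rewrite /in_list mem_cat ?i1 ?i2 ?orbT.
- by apply: (add l1) => //; rewrite /justified /= ?packE.
- apply: (add (l1 ++ l2)); first exact: closed_cat.
  by rewrite /justified /= ?packE; exists y; rewrite /in_list mem_cat ?i1 ?i2 ?orbT.
- have [l2 c2 i2] : exists2 l, closed_list l &
      forall m, m < n -> in_list l (recfun_code f) (pack a m) (h m).+1.
    elim: n IHh {i1} => [|n IH] IHh; first by exists [::].
    have [|l cl il] := IH; first by move=> m lt_mn; apply: IHh; apply: ltnW.
    have [l' cl' il'] := IHh n (ltnSn n).
    exists (l ++ l'); first exact: closed_cat.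
    move=> m; rewrite ltnS leq_eqVlt /in_list mem_cat => /orP[/eqP->|/il ->//].
    by rewrite [X in _ || X]il' orbT.
  apply: (add (l1 ++ l2)); first exact: closed_cat.
  rewrite /justified /= ?packE /in_list mem_cat i1; split=> // m lt_mn.
  by exists (h m); rewrite mem_cat [X in _ || X]i2 ?orbT.
Qed.

(* The entries of the coded list are shifted by one, so that the default value
   [0] of [code_nth] is never an element. *)
Definition code_mem (s z : nat) : bool :=
  has (fun i => code_nth s i == z.+1) (iota 0 s).

Lemma code_memE l z : code_mem (seq_code (map succn l)) z = (z \in l).
Proof.
apply/hasP/idP => [[i _]|zl].
  rewrite code_nthE; case: (ltnP i (size l)) => [lt_i|ge_i].
    by rewrite (nth_map 0) // eqSS => /eqP <-; apply: mem_nth.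
  by rewrite nth_default // size_map.
exists (index z l).
  rewrite mem_iota add0n /=; apply: leq_trans (seq_code_size _).
  by rewrite size_map index_mem.
by rewrite code_nthE (nth_map 0) ?index_mem // nth_index.
Qed.

Lemma code_mem_lt s z : code_mem s z -> z < s.
Proof.
move=> /hasP[i _ /eqP e]; have := code_nth_le s i; rewrite e => le_z.
exact: leq_trans le_z (leq_pred s).
Qed.

Lemma rec_code_mem F G : total_recursive F -> total_recursive G ->
  recursive_pred (fun x => code_mem (F x) (G x)).
Proof.
move=> HF HG; rewrite /code_mem; apply: rec_has => //.
by rec.
Qed.

Ltac rec_code ::= first [apply: rec_code_nth | apply: rec_code_mem].

Definition code_in (s f x y : nat) : bool := code_mem s (pack f (pack x y)).

(** A boolean form of [justified]. Bounding its existential quantifiers by [s] loses nothing,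
    because the value in a listed judgment is smaller than [s]. *)
Definition justified_code (s f x y : nat) : bool :=
  let a := p2 f in
  if p1 f == 0 then y == 0
  else if p1 f == 1 then y == x.+1
  else if p1 f == 2 then y == p1 x
  else if p1 f == 3 then y == p2 x
  else if p1 f == 4 then code_in s (p1 a) x (p1 y) && code_in s (p2 a) x (p2 y)
  else if p1 f == 5 then
    has (fun z => code_in s (p2 a) x z && code_in s (p1 a) z y) (iota 0 s)
  else if p1 f == 6 then
    if p2 x == 0 then code_in s (p1 a) (p1 x) y
    else has (fun z => code_in s f (pack (p1 x) (p2 x).-1) z &&
                code_in s (p2 a) (pack (p1 x) (pack (p2 x).-1 z)) y) (iota 0 s)
  else code_in s a (pack x y) 0 &&
       all (fun m => has (fun k => code_in s a (pack x m) k.+1) (iota 0 s))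
           (iota 0 y).

Lemma code_in_lt s f x y : code_in s f x y -> y < s.
Proof.
move=> /code_mem_lt; apply: leq_trans; rewrite ltnS.
by apply: leq_trans (leq_pack _ _); apply: leq_trans (leq_addl _ _);
   apply: leq_trans (leq_pack _ _); apply: leq_addl.
Qed.

Lemma has_iotaP (P : pred nat) n :
  (forall z, P z -> z < n) -> reflect (exists z, P z) (has P (iota 0 n)).
Proof.
move=> bound; apply: (iffP hasP) => [[z _ Pz]|[z Pz]]; exists z => //.
by rewrite mem_iota bound.
Qed.

Lemma justified_codeP s f x y :
  reflect (justified (code_in s) f x y) (justified_code s f x y).
Proof.
rewrite /justified_code /justified.
case: (p1 f) => [|[|[|[|[|[|[|n]]]]]]] /=; try exact: eqP.
- exact: andP.
- apply: (iffP (has_iotaP _)) => [z /andP[/code_in_lt //]|[z /andP[? ?]]|[z Hz H]];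
  by exists z => //; rewrite Hz H.
- case: (p2 x) => [|m] /=; first exact: idP.
  apply: (iffP (has_iotaP _)) => [z /andP[/code_in_lt //]|[z /andP[? ?]]|[z Hz H]];
  by exists z => //; rewrite Hz H.
- apply: (iffP andP) => -[H0 H]; split=> //.
    move=> m lt_my; have := allP H m; rewrite mem_iota lt_my => /(_ isT) /hasP[k _ Hk].
    by exists k.
  apply/allP => m; rewrite mem_iota => /andP[_ /H [k Hk]].
  apply/hasP; exists k => //; rewrite mem_iota /=.
  exact: ltnW (code_in_lt Hk).
Qed.

(* [s] certifies that the recursive function coded by [e] maps [e] to [1]. *)
Definition halts_by (e s : nat) : bool :=
  code_in s e e 1 &&
  all (fun z => code_mem s z ==> justified_code s (p1 z) (p1 (p2 z)) (p2 (p2 z)))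
      (iota 0 s).

Lemma halts_byP f :
  (exists s, halts_by (recfun_code f) s) <-> reval f (recfun_code f) 1.
Proof.
split=> [[s /andP[ff1 /allP just]]|/justified_complete[l cl il]].
  apply: (justified_sound (M := code_in s)) ff1 => g x y gxy.
  apply/justified_codeP; move: (just (pack g (pack x y))).
  rewrite mem_iota (code_mem_lt gxy) (gxy : code_mem _ _) !packE.
  by move=> /(_ isT).
exists (seq_code (map succn l)).
rewrite /halts_by /code_in code_memE [X in X && _]il /=; apply/allP => z _.
rewrite code_memE; apply/implyP => zl.
apply/justified_codeP; apply: (@justified_sub (in_list l)) => [f' x' y'|].
  by rewrite /code_in code_memE.
by apply: cl; rewrite /in_list !pack_surj.
Qed.

Lemma rec_code_in A B C D : total_recursive A -> total_recursive B ->
  total_recursive C -> total_recursive D ->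
  recursive_pred (fun x => code_in (A x) (B x) (C x) (D x)).
Proof. by move=> *; rewrite /code_in; rec. Qed.

Ltac rec_code ::=
  first [apply: rec_code_nth | apply: rec_code_in | apply: rec_code_mem].

Lemma rec_halts_by F G : total_recursive F -> total_recursive G ->
  recursive_pred (fun x => halts_by (F x) (G x)).
Proof.
move=> HF HG; apply: rec_and; first by rec.
apply: rec_all => //; apply: (rec_if_pred (Q := fun=> true)); rec.
Qed.

(** * Topologies indexed by halting certificates *)

(* [s] only pads the graph with isolated vertices: it does not influence the
   behaviour of the system, but makes the family decidable. *)
Definition halting_family (E : nat -> rel nat) : ptopology := fun G =>
  exists e s, [/\ halts_by e s, top_size G = e + 5 + s, top_init G = 0 :> nat
    & forall v w : 'I_(top_size G), top_edge v w = E e v w :> bool].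

(** The number of vertices exceeds [e] and determines [s] once [e] is guessed, so a bounded search
    settles membership. *)
Definition halting_family_code (E : nat -> rel nat) (c : nat) : bool :=
  let n := code_nth c 0 in
  has (fun e => [&& halts_by e (n - (e + 5)), e + 5 <= n, code_nth c 1 == 0 &
    all (fun v => all (fun w =>
        code_nth (code_nth (code_nth c 2) v) w == E e v w) (iota 0 n)) (iota 0 n)])
    (iota 0 n).

Lemma rec_halting_family_code (E : nat -> rel nat) :
  recursive_pred (fun z => E (p1 z) (p1 (p2 z)) (p2 (p2 z))) ->
  recursive_pred (halting_family_code E).
Proof.
move=> HE; rewrite /halting_family_code; apply: rec_has; last by rec.
apply: rec_and; first by apply: rec_halts_by; rec.
do 2![apply: rec_and; first by rec].
do 2!(apply: rec_all; last by rec).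
apply: rec_eq; first by rec.
have H : total_recursive (fun z =>
    pack (p2 (p1 (p1 z))) (pack (p2 (p1 z)) (p2 z))) by rec.
by apply: rec_ext (rec_comp HE H) => z; rewrite !packE.
Qed.

Lemma topology_code_bit (G : topology) (v w : 'I_(top_size G)) :
  code_nth (code_nth (code_nth (topology_code G) 2) v) w = top_edge v w.
Proof.
rewrite [in code_nth _ 2]/topology_code code_nthE [nth _ _ 2]/= code_nthE.
rewrite (nth_map v) ?size_enum_ord // code_nthE (nth_map v) ?size_enum_ord //.
by rewrite !nth_ord_enum.
Qed.

Lemma halting_family_codeP E (G : topology) :
  reflect (halting_family E G) (halting_family_code E (topology_code G)).
Proof.
rewrite /halting_family_code.
have -> : code_nth (topology_code G) 0 = top_size G by rewrite code_nthE.
have -> : code_nth (topology_code G) 1 = top_init G by rewrite code_nthE.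
apply: (iffP hasP) => [[e _ /and4P[ehs le_e /eqP init0 edges]]|].
  exists e, (top_size G - (e + 5)); split=> //; first by rewrite subnKC.
  move=> v w; have := allP edges v; rewrite mem_iota /= ltn_ord => /(_ isT) /allP/(_ w).
  rewrite mem_iota /= ltn_ord topology_code_bit => /(_ isT) /eqP.
  by case: top_edge; case: (E e v w).
move=> [e [s [ehs size_G init0 edges]]]; exists e.
  by rewrite mem_iota size_G; lia.
apply/and4P; split; rewrite ?init0 //.
- by rewrite size_G addKn.
- by rewrite size_G leq_addr.
apply/allP => v; rewrite mem_iota /= => lt_v; apply/allP => w; rewrite mem_iota /= => lt_w.
by rewrite (topology_code_bit (Ordinal lt_v) (Ordinal lt_w)) edges.
Qed.

Lemma halting_family_computable (E : nat -> rel nat) :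
  recursive_pred (fun z => E (p1 z) (p1 (p2 z)) (p2 (p2 z))) ->
  computable_ptopology (halting_family E).
Proof.
move=> /rec_halting_family_code [f Hf]; exists f => G _.
by have := Hf (topology_code G); case: halting_family_codeP; [left|right].
Qed.

(** Diagonal argument: a decision procedure composed with the map from [e] to the instance [phi e]
    is a recursive function [h]. On the code of [h], the answer 1 yields a certificate, hence a
    topology on which the formula fails; the answer 0 excludes every certificate, hence the formula
    holds on the whole family. *)
Lemma halting_family_undecidable (L : logic) (AP : countType) (Sint : finType)
    (P : template AP Sint) (F : prenex L AP -> Prop) (phi : nat -> prenex L AP)
    (E : nat -> rel nat) :
  (forall e, irreflexive (E e)) ->
  (forall e, F (phi e)) ->
  total_recursive (fun e => prenex_code (phi e)) ->
  (forall (G : topology) e e', e' + 5 <= top_size G -> top_init G = 0 :> nat ->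
     (forall v w : 'I_(top_size G), top_edge v w = E e' v w :> bool) ->
     models P G (phi e) <-> e <> e') ->
  ~ pmcp_decidable (halting_family E) (fun P' => P' = P) F.
Proof.
move=> irrE Fphi Hphi models_phi [f Hf].
have [g Hg] := rec_pack Hphi (rec_const (template_code P)).
pose h := RComp f g.
have step b : reval f (pack (prenex_code (phi (recfun_code h))) (template_code P)) b ->
    reval h (recfun_code h) b by apply: EComp; apply: Hg.
have := Hf (phi (recfun_code h), P) (conj (Fphi _) erefl).
case=> /= -[sat_all /step Hb].
  have [s ehs] := (halts_byP h).2 Hb.
  have lt0 : 0 < recfun_code h + 5 + s by rewrite addnAC addn_gt0 orbT.
  pose edge := [rel v w : 'I_(recfun_code h + 5 + s) | E (recfun_code h) v w].
  have irr : irreflexive edge by move=> v; apply: irrE.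
  pose G := Topology (Ordinal lt0) irr.
  have GE : halting_family E G by exists (recfun_code h), s.
  have [] // := (models_phi G (recfun_code h) (recfun_code h) _ _ _).1 (sat_all G GE) => //=.
  exact: leq_addr.
apply: sat_all => G [e [s [ehs size_G init0 edges]]].
apply/(models_phi _ _ _ _ init0 edges); first by rewrite size_G leq_addr.
move=> eh; rewrite -eh in ehs.
have := (halts_byP h).1 (ex_intro _ s ehs).
by move/(reval_functional Hb).
Qed.

(** * Runs of the token as walks *)

Section TokenWalks.
Variables (AP : countType) (Sint : finType) (p0 : AP).

(** The state [ord_max] holds the token and [ord0] does not. Internal actions are disabled, so every
    step of the system moves the token along an edge. *)
Definition token_trans (q : 'I_2) (a : action Sint) (q' : 'I_2) : bool :=
  match a with
  | Internal _ => false
  | Snd => (q == ord_max) && (q' == ord0)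
  | Rcv => (q == ord0) && (q' == ord_max)
  end.

Fact token_transP q a q' : token_trans q a q' ->
  match a with
  | Internal _ => (q \in [set ord_max]) = (q' \in [set ord_max])
  | Snd => (q \in [set ord_max]) && (q' \notin [set ord_max])
  | Rcv => (q \notin [set ord_max]) && (q' \in [set ord_max])
  end.
Proof. by case: a => [||] //= /andP[/eqP-> /eqP->]; rewrite !inE. Qed.

Fact token_init_nP : ord0 \notin [set ord_max : 'I_2].
Proof. by rewrite inE. Qed.

Lemma ord2_cases (q : 'I_2) : q = ord0 \/ q = ord_max.
Proof. by case: q => -[|[|//]] lt_q; [left|right]; apply: val_inj. Qed.

Fact token_trans_total q : exists a q', token_trans q a q'.
Proof.
by case: (ord2_cases q) => ->; [exists Rcv, ord_max|exists Snd, ord0].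
Qed.

Lemma omega_power_pairs (a : nat -> action Sint) x y :
  (forall i, a i = if odd i then y else x) -> omega_power (alternation x y) a.
Proof.
move=> axy; exists double; split=> // k; rewrite ltn_double ltnSn; split=> //.
exists [::], [::]; rewrite /index_iota doubleS -addn2 addKn /= !axy /=.
by rewrite odd_double.
Qed.

Fact token_alternate (q : nat -> 'I_2) (a : nat -> action Sint) :
  (forall i, token_trans (q i) (a i) (q i.+1)) ->
  omega_power (alternation Snd Rcv) a \/ omega_power (alternation Rcv Snd) a.
Proof.
move=> qa.
have stepA i : a i = if q i == ord_max then Snd else Rcv.
  by have := qa i; case: (a i) => //= /andP[/eqP->].
have stepQ i : (q i.+1 == ord_max) = (q i != ord_max).
  by have := qa i; case: (a i) => //= /andP[/eqP-> /eqP->].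
have parity i : (q i == ord_max) = odd i (+) (q 0 == ord_max).
  by elim: i => //= i IH; rewrite stepQ IH addNb.
case: (boolP (q 0 == ord_max)) => q0; [left|right]; apply: omega_power_pairs => i;
  by rewrite stepA parity ?q0 ?(negbTE q0); case: odd.
Qed.

Definition token_template : template AP Sint := {|
  pt_token := [set ord_max];
  pt_init_t := ord_max;
  pt_init_n := ord0;
  pt_trans := token_trans;
  pt_label := fun q => if q == ord_max then [:: p0] else [::];
  pt_init_tP := set11 ord_max;
  pt_init_nP := token_init_nP;
  pt_transP := token_transP;
  pt_total := token_trans_total;
  pt_alternate := token_alternate
|}.

Variable G : topology.
Let V := 'I_(top_size G).
Let M := token_system token_template G.

(** By [token_init] and [token_step], all reachable configurations have this form, so runs can be
    read as walks in the graph. *)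
Definition token_at (v : V) : lts_state M :=
  [ffun u => if u == v then ord_max else ord0] : {ffun V -> 'I_2}.

Lemma token_at_eq v u : (token_at v u == ord_max) = (u == v).
Proof. by rewrite ffunE; case: (u == v). Qed.

Lemma token_at_inj : injective token_at.
Proof. by move=> v w vw; apply/eqP; rewrite -token_at_eq -vw token_at_eq. Qed.

Lemma token_init s : @lts_init _ M s <-> s = token_at (top_init G).
Proof. by []. Qed.

Lemma token_label v u : @lts_label _ M (token_at v) (p0, u) <-> u = v.
Proof.
by rewrite /= token_at_eq; case: eqP => [->|uv]; rewrite ?inE ?eqxx //; split.
Qed.

Lemma token_step v l s : @lts_trans _ M (token_at v) l s ->
  exists2 w, top_edge v w & s = token_at w.
Proof.
case: l => [a [u []] //|/= [u [w []]]].
move=> uw /andP[]; rewrite token_at_eq => /eqP <- /eqP su /andP[_ /eqP sw] s_else.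
exists w => //; apply/ffunP => t; rewrite ffunE; case: (eqVneq t w) => [->//|tw].
case: (eqVneq t u) => [->//|tu]; rewrite s_else //.
by rewrite ffunE (negbTE tu).
Qed.

Lemma token_move v w : top_edge v w -> @lts_trans _ M (token_at v) None (token_at w).
Proof.
move=> vw; have vNw : v != w by apply: contraTneq vw => ->; rewrite top_irrefl.
exists v, w; rewrite /= !ffunE !eqxx (negbTE vNw) [w == v]eq_sym (negbTE vNw); split=> // u uv uw.
by rewrite !ffunE (negbTE uv) (negbTE uw).
Qed.

Definition walk (w : nat -> V) := forall i, top_edge (w i) (w i.+1).

Lemma walk_path w : walk w -> is_path (fun i => token_at (w i)).
Proof. by move=> walk_w i; exists None; apply: token_move. Qed.

Lemma path_walk v (pi : nat -> lts_state M) : pi 0 = token_at v -> is_path pi ->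
  exists w, [/\ w 0 = v, walk w & forall i, pi i = token_at (w i)].
Proof.
move=> pi0 path_pi.
have at_i i : exists u, pi i == token_at u.
  elim: i => [|i [u /eqP pi_u]]; first by exists v; apply/eqP.
  have [a] := path_pi i; rewrite pi_u => /token_step[w _ ->].
  by exists w.
(* Equality of configurations is decidable, so the position of the token is chosen without an
   axiom. *)
pose w i := xchoose (at_i i).
have pi_w i : pi i = token_at (w i) by apply/eqP/(xchooseP (at_i i)).
exists w; split=> // [|i].
  by apply: token_at_inj; rewrite -pi_w.
have [a] := path_pi i; rewrite !pi_w => /token_step[u vu].
by move/token_at_inj=> ->.
Qed.

Definition ctl_at (f : ctlx (AP * V)) (v : V) : Prop :=
  @ctlx_holds _ M f (token_at v).

Lemma ctl_at_atom v u : ctl_at (CAtom (p0, u)) v <-> u = v.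
Proof. exact: token_label. Qed.

Lemma ctl_at_not f v : ctl_at (CNot f) v <-> ~ ctl_at f v.
Proof. by []. Qed.

Lemma ctl_at_and f g v : ctl_at (CAnd f g) v <-> ctl_at f v /\ ctl_at g v.
Proof. by []. Qed.

Lemma ctl_at_EU f g v : ctl_at (CEUntil f g) v <->
  exists w, [/\ w 0 = v, walk w &
    until (fun i => ctl_at f (w i)) (fun i => ctl_at g (w i))].
Proof.
split=> [[pi [pi0 path_pi [i [gi fi]]]]|[w [w0 walk_w u]]]; last first.
  exists (fun i => token_at (w i)); split=> //; first by rewrite w0.
  exact: walk_path.
have [w [w0 walk_w pi_w]] := path_walk pi0 path_pi.
exists w; split=> //; exists i; split; first by rewrite /ctl_at -pi_w.
by move=> j /fi; rewrite /ctl_at -pi_w.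
Qed.

Lemma ctl_at_EU_step f g v w : ctl_at f v -> top_edge v w ->
  ctl_at (CEUntil f g) w -> ctl_at (CEUntil f g) v.
Proof.
move=> fv vw /ctl_at_EU[t [t0 walk_t [i [gi fi]]]]; apply/ctl_at_EU.
exists (fun k => if k is k'.+1 then t k' else v); split=> //.
  by case=> [|k]; rewrite ?t0.
by exists i.+1; split=> // -[|j] //; apply: fi.
Qed.

(** A walk has to be supplied because the semantics asks for an infinite path, and the padding
    vertices of the families have no successor. *)
Lemma ctl_at_EU_now f g w : walk w -> ctl_at g (w 0) -> ctl_at (CEUntil f g) (w 0).
Proof. by move=> walk_w gw; apply/ctl_at_EU; exists w; split=> //; exists 0. Qed.

End TokenWalks.

(** * Lassos and LTL *)

(** The path [0, 1, ..., e + 2] with an edge from [e + 2] back to [e + 1]; exactly one infinite walk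
    starts at 0. *)
Definition lasso_edge (e v w : nat) : bool :=
  (v <= e.+1) && (w == v.+1) || (v == e.+2) && (w == e.+1).

Lemma lasso_edge_irreflexive e : irreflexive (lasso_edge e).
Proof. by move=> v; rewrite /lasso_edge; lia. Qed.

Lemma rec_lasso_edge :
  recursive_pred (fun z => lasso_edge (p1 z) (p1 (p2 z)) (p2 (p2 z))).
Proof. by rewrite /lasso_edge; rec. Qed.

Definition lasso (e i : nat) : nat := iter i (fun v => if v <= e.+1 then v.+1 else e.+1) 0.

Lemma lassoS e i :
  lasso e i.+1 = if lasso e i <= e.+1 then (lasso e i).+1 else e.+1.
Proof. by []. Qed.

Lemma lasso_small e i : i <= e.+2 -> lasso e i = i.
Proof.
elim: i => // i IH lt_i; rewrite lassoS IH ?(ltnW lt_i) //.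
by rewrite -ltnS lt_i.
Qed.

Lemma lasso_le e i : lasso e i <= e.+2.
Proof. by elim: i => // i _; rewrite lassoS; case: ifP. Qed.

Lemma lasso_edge_lasso e i : lasso_edge e (lasso e i) (lasso e i.+1).
Proof.
rewrite /lasso_edge lassoS; have := lasso_le e i.
by case: (leqP (lasso e i) e.+1); lia.
Qed.

Lemma lasso_edge_eq e i w : lasso_edge e (lasso e i) w -> w = lasso e i.+1.
Proof.
rewrite /lasso_edge lassoS.
by case: (leqP (lasso e i) e.+1); lia.
Qed.

(** The entry point [e + 1] of the 2-cycle is the first position whose vertex recurs two steps
    later, which is what the formula tests. *)
Lemma lasso_period e i : (lasso e i == lasso e i.+2) = (e < i).
Proof.
case: (ltnP e i) => [|le_i]; last by rewrite !lasso_small; lia.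
elim: i => // i IH; rewrite ltnS leq_eqVlt => /orP[/eqP<-|/IH/eqP ei].
  by rewrite (lassoS e e.+2) !lasso_small // ltnn eqxx.
by rewrite (lassoS e i) ei -lassoS eqxx.
Qed.

(* Each variable after the first is bound to an out-neighbour of the previous
   one, so that the quantifiers range over the walks of length [n]. *)
Definition walk_prefix (n : nat) : seq quantifier :=
  QForall RAll :: [seq QForall (RNbrs j) | j <- iota 0 n].

Lemma walk_prefix_closed n : prefix_closed 0 (walk_prefix n).
Proof.
suff later m k : k <= m ->
    prefix_closed m.+1 [seq QForall (RNbrs j) | j <- iota k n] by exact: later.
by elim: n m k => //= n IH m k le_km; rewrite ltnS le_km IH.
Qed.

Lemma walk_prefix_code N : total_recursive N ->
  total_recursive (fun k => seq_code (map quantifier_code (walk_prefix (N k)))).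
Proof.
move=> HN; apply: (@rec_ext (fun k =>
    seq_code (pack 0 (pack 0 0) :: [seq pack 0 (pack 2 j) | j <- iota 0 (N k)]))).
  by move=> k; rewrite /walk_prefix map_cons -map_comp.
apply/rec_succ/rec_pack; first by rec.
by apply: (@rec_seq_code_iota (fun _ j => pack 0 (pack 2 j))); rec.
Qed.

(** * Quantifier prefixes that range over walks *)

Section WalkModels.
Variables (L : logic) (AP : countType) (Sint : finType).
Variables (P : template AP Sint) (G : topology) (f : formula L (AP * nat)).
Let V := 'I_(top_size G).

Definition sat_at (env : seq V) : Prop :=
  sat (token_system P G) (fmap (fun pj => (pj.1, value env pj.2)) f).

Lemma models_walk n :
  models P G (@Prenex L AP (walk_prefix n) f) <->
  forall x t, path (@top_edge G) x t -> size t = n -> sat_at (x :: t).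
Proof.
(* The environment [x :: s] is the walk chosen so far; its last vertex is the value of the variable
   [size s], to which the next quantifier refers. *)
suff ext k (x : V) s :
    models_under P [seq QForall (RNbrs j) | j <- iota (size s) k] f (x :: s) <->
    forall t, path (@top_edge G) (last x s) t -> size t = k -> sat_at (x :: s ++ t).
  by split=> [H x|H x _]; [have /ext := H x isT | apply/(ext _ _ [::]) => t; apply: H].
elim: k s => [|k IH] s.
  split=> [H [|//] _ _|/(_ [::] isT erefl)]; first by rewrite cats0.
  rewrite cats0; exact: id.
rewrite /= /in_range.
have -> : value (x :: s) (size s) = last x s := nth_last _ (x :: s).
have {}IH g := IH (rcons s g); split=> [H [//|g t] /= /andP[sg gt] [size_t]|H g sg].
  have := H g sg; rewrite -(size_rcons s g) => /IH; rewrite last_rcons => /(_ t gt size_t).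
  by rewrite cat_rcons.
rewrite -(size_rcons s g); apply/IH => t; rewrite last_rcons cat_rcons => gt size_t.
by apply: H; rewrite /= ?sg ?size_t.
Qed.
End WalkModels.

Section LassoFormulas.
Variables (A : Type) (a : nat -> A).

(** There is no atom for equality of index variables. As there is only one token, seeing it at both
    variables at once means that they name the same vertex, provided that the run visits it. *)
Definition meet (i j : nat) : ltlx A :=
  LUntil (LTrue A) (LAnd (LAtom (a i)) (LAtom (a j))).

(** The guard [a 0] selects the walks from the initial vertex, where the variables follow the run.
    On the lasso of parameter [e], the two tests then make [k + 1] the first position whose vertex
    recurs two steps later, that is, [k = e]. *)
Definition lasso_formula (k : nat) : ltlx A :=
  LNot (LAnd (LAtom (a 0)) (LAnd (meet k.+1 k.+3) (LNot (meet k k.+2)))).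

End LassoFormulas.

Definition lasso_prenex (AP : countType) (p0 : AP) (k : nat) : prenex LTLX AP :=
  @Prenex LTLX AP (walk_prefix k.+3) (lasso_formula (pair p0) k).

Lemma lasso_prenex_code (AP : countType) (p0 : AP) :
  total_recursive (fun k => prenex_code (lasso_prenex p0 k)).
Proof.
apply: rec_pack; first by apply: walk_prefix_code; rec.
by rewrite /=; rec.
Qed.

Lemma lasso_prenex_closed (AP : countType) (p0 : AP) k :
  prenex_closed (lasso_prenex p0 k).
Proof.
split; first exact: walk_prefix_closed.
by rewrite [px_prefix _]/= /walk_prefix [size _]/= size_map size_iota /=; lia.
Qed.

Section Lasso.
Variables (AP : countType) (Sint : finType) (p0 : AP) (G : topology) (e : nat).
Hypotheses (size_G : e + 5 <= top_size G) (init_G : top_init G = 0 :> nat).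
Hypothesis edge_G :
  forall v w : 'I_(top_size G), top_edge v w = lasso_edge e v w.

Let V := 'I_(top_size G).
Let M := token_system (token_template Sint p0) G.

Lemma walk_lasso (w : nat -> V) : w 0 = 0 :> nat -> walk w -> forall i, w i = lasso e i :> nat.
Proof.
move=> w0 walk_w; elim=> // i IH.
by have := walk_w i; rewrite edge_G IH; apply: lasso_edge_eq.
Qed.

Lemma path_lasso (x : V) t : x = 0 :> nat -> path (@top_edge G) x t ->
  forall i, i <= size t -> value (x :: t) i = lasso e i :> nat.
Proof.
move=> x0 /(pathP (top_init G)) xt; elim=> // i IH lt_i.
by have := xt i lt_i; rewrite edge_G -/(value (x :: t) i) IH ?(ltnW lt_i) //; apply: lasso_edge_eq.
Qed.

Lemma meet_holds (w : nat -> V) (pi : nat -> lts_state M) (a : nat -> V) i j :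
  (forall n, pi n = token_at Sint p0 (w n)) ->
  @ltlx_holds _ M (meet (fun n => (p0, a n)) i j) pi <->
  exists n, a i = w n /\ a j = w n.
Proof.
move=> pi_w; split=> [[n [[ai aj] _]]|[n [ai aj]]]; exists n.
  by move: ai aj; rewrite /= !addn0 pi_w => /token_label -> /token_label ->.
by split=> //; split; rewrite /= !addn0 pi_w; apply/token_label.
Qed.

Lemma lasso_formula_holds (w : nat -> V) (pi : nat -> lts_state M) (a : nat -> V) k :
  w 0 = 0 :> nat -> walk w -> (forall n, pi n = token_at Sint p0 (w n)) ->
  (a 0 = w 0 -> forall i, i <= k.+3 -> a i = lasso e i :> nat) ->
  @ltlx_holds _ M (lasso_formula (fun n => (p0, a n)) k) pi <->
  (a 0 = w 0 -> k <> e).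
Proof.
move=> w0 walk_w pi_w a_lasso.
have w_lasso := walk_lasso w0 walk_w.
have meetE i j : a 0 = w 0 -> i <= k.+3 -> j <= k.+3 ->
    @ltlx_holds _ M (meet (fun n => (p0, a n)) i j) pi <-> lasso e i = lasso e j.
  move=> a0 le_i le_j; rewrite (meet_holds _ _ _ pi_w) -!a_lasso //.
  (* The run and the variables follow the same lasso, so the token is at the [i]-th variable at time
     [i]. *)
  split=> [[n [-> ->]] //|/val_inj aij]; exists i; rewrite -aij.
  by split; apply: val_inj; rewrite /= a_lasso ?w_lasso.
have -> : @ltlx_holds _ M (lasso_formula (fun n => (p0, a n)) k) pi <->
    ~ (a 0 = w 0 /\ @ltlx_holds _ M (meet (fun n => (p0, a n)) k.+1 k.+3) pi /\
       ~ @ltlx_holds _ M (meet (fun n => (p0, a n)) k k.+2) pi).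
  by rewrite -(token_label Sint p0 (w 0) (a 0)) -pi_w.
have [a0|/eqP a0] := eqVneq (a 0) (w 0); last by split=> [_ //|_ []].
rewrite (meetE k.+1 k.+3) ?(meetE k k.+2) //; [|lia..].
have period i : lasso e i = lasso e i.+2 <-> e < i.
  by rewrite -lasso_period; split=> /eqP.
rewrite !period; split=> [H _ ke|/(_ a0) ke [_]]; last by lia.
by apply: H; split=> //; lia.
Qed.

Lemma lasso_models k :
  models (token_template Sint p0) G (lasso_prenex p0 k) <-> k <> e.
Proof.
rewrite /lasso_prenex models_walk.
have satE (x : V) t : path (@top_edge G) x t -> size t = k.+3 ->
    forall w pi, w 0 = top_init G -> walk w ->
    (forall n, pi n = token_at Sint p0 (w n)) ->
    @ltlx_holds _ M (ltlx_map (fun pj => (pj.1, value (x :: t) pj.2))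
                      (lasso_formula (pair p0) k)) pi <->
    (x = top_init G -> k <> e).
  move=> xt size_t w pi w0 walk_w pi_w.
  have := @lasso_formula_holds w pi (value (x :: t)) k.
  rewrite w0 init_G => /(_ erefl walk_w pi_w); apply.
  by move=> x0 i; rewrite -size_t; apply: path_lasso; rewrite // -init_G -x0.
split=> [H|ke x t xt size_t pi /token_init pi0 path_pi]; last first.
  have [w [w0 walk_w pi_w]] := path_walk pi0 path_pi.
  exact/(satE _ _ xt size_t _ _ w0 walk_w pi_w).
(* To derive [k <> e], the lasso walk itself serves both as the run and as the values of the
   variables. *)
have lt_lasso i : lasso e i < top_size G by have := lasso_le e i; lia.
pose w i : V := Ordinal (lt_lasso i).
have walk_w : walk w by move=> i; rewrite edge_G lasso_edge_lasso.
have w0 : w 0 = top_init G by apply: val_inj; rewrite /= init_G.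
pose t := [seq w i.+1 | i <- iota 0 k.+3].
have size_t : size t = k.+3 by rewrite size_map size_iota.
have xt : path (@top_edge G) (w 0) t.
  rewrite /t; elim: k.+3 (0) => //= n IH i; rewrite walk_w; exact: IH.
have path_w := walk_path Sint p0 walk_w.
have := H (w 0) t xt size_t (fun i => token_at Sint p0 (w i)).
move=> /(_ _ path_w) holds; apply: (satE _ _ xt size_t w _ w0 walk_w _).1 => //.
by apply: holds; apply/token_init; rewrite w0.
Qed.

End Lasso.

Theorem lasso_undecidable (AP : countType) (Sint : finType) (p0 : AP) :
  ~ pmcp_decidable (halting_family lasso_edge)
      (fun P' => P' = token_template Sint p0) (@prenex_closed LTLX AP).
Proof.
apply: (halting_family_undecidable (phi := lasso_prenex p0)).
- exact: lasso_edge_irreflexive.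
- exact: lasso_prenex_closed.
- exact: lasso_prenex_code.
- by move=> G e e' size_G init_G edge_G; apply: lasso_models.
Qed.

(** * Ladders and CTL *)

(* The initial vertex [0] leads to a descending chain [e + 3, ..., 3] whose
   vertices also have an exit, alternately to [0] and to the sink [{1, 2}]. *)
Definition ladder_edge (e v w : nat) : bool :=
  [|| (v == 0) && (w == e + 3), (v == 1) && (w == 2),
      [&& 1 < v <= e + 3, v != 3 & w == v.-1] | (2 < v <= e + 3) && (w == ~~ odd v)].

Lemma ladder_edge_irreflexive e : irreflexive (ladder_edge e).
Proof. by move=> v; rewrite /ladder_edge; case: (odd v); lia. Qed.

Lemma rec_ladder_edge :
  recursive_pred (fun z => ladder_edge (p1 z) (p1 (p2 z)) (p2 (p2 z))).
Proof.
rewrite /ladder_edge; rec.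
Qed.

Section LadderFormulas.
Variables (A : Type) (a : A).

(** When [a] marks the initial vertex of a ladder, this separates the sink from vertex 0 and the
    chain. *)
Definition reach_init : ctlx A := CEUntil (CTrue A) (CAtom a).

(* [level j] holds at the chain vertices from [j + 3] on: vertex [j + 3] is the
   only one from which one of the two kinds of exits cannot be reached
   within [level j]. *)
Fixpoint level (j : nat) : ctlx A :=
  if j is j'.+1 then
    CAnd (level j')
      (CEUntil (level j') (if odd j' then CAtom a else CNot reach_init))
  else CAnd (CNot (CAtom a)) reach_init.

(** The first conjunct makes the index variable name the initial vertex. From there,
    [CEUntil (CAtom a)] reaches a level only by the single step to the top of the chain, so the
    other two conjuncts say that [e] is the parameter of the ladder. *)
Definition ladder_formula (e : nat) : ctlx A :=
  CNot (CAnd (CAtom a) (CAnd (CEUntil (CAtom a) (level e))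
                             (CNot (CEUntil (CAtom a) (level e.+1))))).

Lemma level_code c : total_recursive (fun j => ctlx_code c (level j)).
Proof.
pose B j r := pack 3 (pack r (pack 4 (pack r
  (if odd j then ctlx_code c (CAtom a) else ctlx_code c (CNot reach_init))))).
apply: (@rec_ext (fun j => nat_rect (fun=> nat) (ctlx_code c (level 0)) B j)).
  by elim=> // j IH; rewrite /= IH /B; case: (odd j).
by apply: (@rec_nat_rect (fun=> B)); rewrite /B; rec.
Qed.

Lemma ladder_formula_code c : total_recursive (fun e => ctlx_code c (ladder_formula e)).
Proof.
have H := level_code c; rewrite /ladder_formula [X in total_recursive X]/=.
have H' := rec_comp H (rec_succ rec_id).
by rec.
Qed.

Lemma level_atoms j (P : pred A) : P a -> all P (ctlx_atoms (level j)).
Proof.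
by move=> Pa; elim: j => [|j IH] /=; rewrite ?all_cat ?IH ?Pa //; case: odd; rewrite /= Pa.
Qed.

Lemma ladder_formula_atoms e (P : pred A) :
  P a -> all P (ctlx_atoms (ladder_formula e)).
Proof.
move=> Pa; have La j := level_atoms j Pa.
by rewrite /= Pa !all_cat !La /= !all_cat !La Pa /=; case: odd; rewrite /= ?Pa.
Qed.

End LadderFormulas.

Lemma level_map (A B : Type) (h : A -> B) a j :
  ctlx_map h (level a j) = level (h a) j.
Proof. by elim: j => //= j ->; case: odd. Qed.

Lemma ladder_formula_map (A B : Type) (h : A -> B) a e :
  ctlx_map h (ladder_formula a e) = ladder_formula (h a) e.
Proof. by rewrite /ladder_formula /= !level_map; case: odd. Qed.

Section Ladder.
Variables (AP : countType) (Sint : finType) (p0 : AP) (G : topology) (e : nat).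
Hypotheses (size_G : e + 5 <= top_size G) (init_G : top_init G = 0 :> nat).
Hypothesis edge_G :
  forall v w : 'I_(top_size G), top_edge v w = ladder_edge e v w.

Let V := 'I_(top_size G).
Let init := (p0, top_init G).
Notation ctl := (@ctl_at AP Sint p0 G).

Lemma ladder_vertex k : k <= e + 3 -> exists v : V, v = k :> nat.
Proof.
move=> le_k; have lt_k : k < top_size G by lia.
by exists (Ordinal lt_k).
Qed.

Lemma ladder_walk (v : V) : v <= e + 3 -> exists w : nat -> V, w 0 = v /\ walk w.
Proof.
move=> le_v.
have succ (u : V) : u <= e + 3 -> exists t : V, top_edge u t && (t <= e + 3).
  move=> le_u; have [k [le_k uk]] : exists k, k <= e + 3 /\ ladder_edge e u k.
    rewrite /ladder_edge; case: (val u) le_u => [|[|[|[|m]]]] le_m;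
    by [exists (e + 3); lia|exists 2; lia|exists 1; lia|exists 0; lia|exists m.+3; lia].
  by have [t tk] := ladder_vertex le_k; exists t; rewrite edge_G tk uk.
(* The default [u] is never taken at a vertex up to [e + 3]. *)
pose next (u : V) := odflt u [pick t : V | top_edge u t && (t <= e + 3)].
have nextP (u : V) : u <= e + 3 -> top_edge u (next u) && (next u <= e + 3).
  move=> /succ[t ut]; rewrite /next; case: pickP => // /(_ t).
  by rewrite ut.
have le_w i : iter i next v <= e + 3 by elim: i => //= i /nextP /andP[].
by exists (fun i => iter i next v); split=> // i; have /andP[] := nextP _ (le_w i).
Qed.

Lemma ctl_EU_now f g (v : V) : v <= e + 3 -> ctl g v -> ctl (CEUntil f g) v.
Proof. by move=> /ladder_walk[w [<- walk_w]]; apply: ctl_at_EU_now. Qed.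

Lemma ctl_init (v : V) : ctl (CAtom init) v <-> v = 0 :> nat.
Proof.
split=> [/ctl_at_atom <- //|v0]; apply/ctl_at_atom/val_inj.
by rewrite /= init_G v0.
Qed.

Lemma ctl_reach_init (v : V) : v <= e + 3 ->
  ctl (reach_init init) v <-> v = 0 :> nat \/ 2 < v.
Proof.
move=> le_v; split=> [/ctl_at_EU[w [w0 walk_w [i [/ctl_init wi _]]]]|].
  case: (posnP v) => [->|v_gt0]; first by left.
  right; rewrite ltnNge; apply/negP => v_le2.
  have : 0 < w i <= 2.
    elim: {wi} i => [|i]; first by rewrite w0 v_gt0.
    have := walk_w i; rewrite edge_G /ladder_edge.
    by case: (odd _); lia.
  by rewrite wi.
case=> [v0|v_gt2]; first by apply/ctl_EU_now/ctl_init.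
(* Descend the chain one vertex at a time; vertex 3 is odd and hence exits to 0. *)
have [k vk] : exists k, v = k + 3 :> nat by exists (v - 3); lia.
elim: k v vk le_v {v_gt2} => [|k IH] v vk le_v.
  have [//|u u0] := @ladder_vertex 0.
  apply: (@ctl_at_EU_step _ _ _ _ _ _ _ u) => //; last by apply/ctl_EU_now/ctl_init; lia.
  by rewrite edge_G /ladder_edge vk u0; lia.
have [|u uk] := @ladder_vertex (k + 3); first by lia.
apply: (@ctl_at_EU_step _ _ _ _ _ _ _ u) => //; last by apply: IH => //; lia.
by rewrite edge_G /ladder_edge vk uk; lia.
Qed.

(** The target of the until is entered through an exit of a vertex with the parity of [j]. Vertex
    [j + 3] has the other parity, and its successors satisfy neither the target nor [level j]. A
    higher vertex has the right exit itself or finds it one step down the chain. *)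
Lemma ctl_level j (v : V) : v <= e + 3 -> ctl (level init j) v <-> j + 3 <= v.
Proof.
elim: j v => [|j IH] v le_v.
  by rewrite ctl_at_and ctl_at_not ctl_init ctl_reach_init //; lia.
set c := if odd j then CAtom init else CNot (reach_init init).
have ctl_c (u : V) : u <= e + 3 ->
    ctl c u <-> if odd j then u = 0 :> nat else 0 < u <= 2.
  move=> le_u; rewrite /c; case: (odd j); first exact: ctl_init.
  by rewrite ctl_at_not ctl_reach_init //; lia.
rewrite [level _ _.+1]/= ctl_at_and -/c IH //; split=> [[v_ge /ctl_at_EU[w [w0 walk_w [i [wi_c wi]]]]]|v_ge].
  rewrite addSn ltn_neqAle v_ge andbT; apply/eqP => vj.
  have le_w k : w k <= e + 3.
    elim: k => [|k]; first by rewrite w0.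
    have := walk_w k; rewrite edge_G /ladder_edge; lia.
  move/(ctl_c _ (le_w i)): wi_c; case: i wi => [|[|i]] wi.
  - by rewrite w0; case: odd; lia.
  - have := walk_w 0; rewrite w0 edge_G /ladder_edge -vj oddD /=.
    by case: odd; lia.
  - have /(IH _ (le_w 1)) := wi 1 isT.
    have := walk_w 0; rewrite w0 edge_G /ladder_edge -vj oddD /=.
    by case: odd; lia.
split; first by lia.
have exit (u : V) : u <= e + 3 -> j + 3 <= u -> odd u = odd j ->
    ctl (CEUntil (level init j) c) u.
  move=> le_u u_ge odd_u.
  (* Read as a number, [~~ odd j] is the exit of the chain vertices with the parity of [j]. *)
  have [|t tj] := @ladder_vertex (~~ odd j); first by case: odd; lia.
  apply: (@ctl_at_EU_step _ _ _ _ _ _ _ t); first by apply/IH.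
    by rewrite edge_G /ladder_edge odd_u tj; case: odd; lia.
  have le_t : t <= e + 3 by rewrite tj; case: odd; lia.
  by apply: ctl_EU_now => //; apply/ctl_c => //; rewrite tj; case: odd.
case: (boolP (odd v == odd j)) => [/eqP/exit|odd_v]; first by apply; lia.
have [|u uv] := @ladder_vertex v.-1; first by lia.
apply: (@ctl_at_EU_step _ _ _ _ _ _ _ u); first by apply/IH => //; lia.
  by rewrite edge_G /ladder_edge uv; lia.
apply: exit; rewrite ?uv; try lia.
Qed.

Lemma ctl_init_level j (v : V) : v = 0 :> nat ->
  ctl (CEUntil (CAtom init) (level init j)) v <-> j <= e.
Proof.
move=> v0; split=> [/ctl_at_EU[w [w0 walk_w [i [wi_j wi]]]]|le_je].
  have w1 : w 1 = e + 3 :> nat.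
    by have := walk_w 0; rewrite edge_G /ladder_edge w0 v0; lia.
  (* The level is not met at time 0; at time 1 the walk is at the top [e + 3]; a later time would
     require the token to be at 0 at time 1. *)
  case: i wi_j wi => [|[|i]] wi_j wi.
  - by move/ctl_level: wi_j; rewrite w0 v0; lia.
  - by move/ctl_level: wi_j; rewrite w1; lia.
  - by have /ctl_init := wi 1 isT; lia.
have [|u uv] := @ladder_vertex (e + 3); first by lia.
apply: (@ctl_at_EU_step _ _ _ _ _ _ _ u); first exact/ctl_init.
  by rewrite edge_G /ladder_edge uv v0; lia.
by apply: ctl_EU_now; [|apply/ctl_level]; lia.
Qed.

Definition ladder_prenex (k : nat) : prenex CTLX AP :=
  @Prenex CTLX AP [:: QForall RAll; QForall RAll] (ladder_formula (p0, 0) k).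

Lemma ladder_models k :
  models (token_template Sint p0) G (ladder_prenex k) <-> k <> e.
Proof.
have sat_x (x : V) : sat (token_system (token_template Sint p0) G)
      (ladder_formula (p0, x) k : formula CTLX _) <-> (x = top_init G -> k <> e).
  have atx : ctl (ladder_formula (p0, x) k) (top_init G) <-> (x = top_init G -> k <> e).
    rewrite /ladder_formula ctl_at_not !ctl_at_and ctl_at_not ctl_at_atom.
    case: (eqVneq x (top_init G)) => [->|/eqP ne_x]; last by split=> [_ //|_ []].
    rewrite !ctl_init_level //; split=> [H _ ke|/(_ erefl) ke [_]]; last by lia.
    by apply: H; split=> //; lia.
  by rewrite -atx; split=> [H|H s ->]; [apply: H|].
split=> [H|ke x _ y _].
  have : sat (token_system (token_template Sint p0) G)
      (ctlx_map _ (ladder_formula (p0, 0) k) : formula CTLX _) :=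
    H (top_init G) isT (top_init G) isT.
  by rewrite ladder_formula_map => /sat_x; apply.
change (sat (token_system (token_template Sint p0) G)
  (ctlx_map (fun pj => (pj.1, value [:: x; y] pj.2)) (ladder_formula (p0, 0) k)
    : formula CTLX _)).
by rewrite ladder_formula_map; apply/sat_x.
Qed.

End Ladder.

Theorem ladder_undecidable (AP : countType) (Sint : finType) (p0 : AP) :
  ~ pmcp_decidable (halting_family ladder_edge)
      (fun P' => P' = token_template Sint p0) (@k_indexed 2 CTLX AP).
Proof.
apply: (halting_family_undecidable (phi := ladder_prenex p0)).
- exact: ladder_edge_irreflexive.
- by move=> e; split=> //; split=> //; apply: ladder_formula_atoms.
- by apply: rec_pack; [exact: rec_const|exact: ladder_formula_code].
- by move=> G e e' size_G init_G edge_G; apply: ladder_models.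
Qed.

(* The propositions AP (at least one) and the internal actions Sint are those
   over which process templates are built. *)
Theorem theorem8 (AP : countType) (Sint : finType) (p0 : AP) :
  exists (P : template AP Sint) (G H : ptopology),
    [/\ computable_ptopology G,
        computable_ptopology H,
        ~ pmcp_decidable G (fun P' => P' = P) (@prenex_closed LTLX AP)
      & ~ pmcp_decidable H (fun P' => P' = P) (@k_indexed 2 CTLX AP)].
Proof.
exists (token_template Sint p0), (halting_family lasso_edge), (halting_family ladder_edge).
split.
- exact: halting_family_computable rec_lasso_edge.
- exact: halting_family_computable rec_ladder_edge.
- exact: lasso_undecidable.
- exact: ladder_undecidable.
Qed.
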